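(* Let $K$ be a convex set that is affinely isomorphic to the state space of a JB algebra. If $K$ is not a simplex, then the set $\partial_e K$ of extreme points of $K$ has cardinality at least that of $\mathbb{R}$.
   Context: A Jordan algebra is a real vector space with a commutative bilinear product $\circ$ satisfying $((A\circ A)\circ B)\circ A=(A\circ A)\circ(B\circ A)$. A JB algebra is a unital Jordan algebra complete with respect to a norm satisfying $\|A\circ B\|\le\|A\|\|B\|$, $\|A\circ A\|=\|A\|^2$, $\|A\circ A\|\le\|A\circ A+B\circ B\|$. A state is a continuous linear $\omega:\mathcal{A}\to\mathbb{R}$ with $\omega(I)=1$ and $\omega(A\circ A)\ge0$; the state space is the convex set of states. An affine isomorphism is a bijection preserving convex combinations. $K$ is called a simplex if for all extreme points $w,x,y,z$ of $K$ and $\lambda,\mu\in(0,1)$, $\lambda w+(1-\lambda)x=\mu y+(1-\mu)z$ implies $w=y$ or $w=z$. *)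

(* Defs.v *)
From HB Require Import structures.
From mathcomp Require Import all_boot all_order all_algebra.
From mathcomp Require Import all_classical all_reals all_analysis.
Set Implicit Arguments. Unset Strict Implicit. Unset Printing Implicit Defensive.
Import Order.TTheory GRing.Theory Num.Theory.
Import numFieldNormedType.Exports.
Local Open Scope classical_set_scope.
Local Open Scope ring_scope.

Definition is_JB_algebra (R : realType) (V : completeNormedModType R)
  (prod : V -> V -> V) (I : V) : Prop :=
  (* bilinear (linear in the first argument; with commutativity, in both) *)
  (forall (a : R) (x y z : V), prod (a *: x + y) z = a *: prod x z + prod y z) /\
  (forall x y : V, prod x y = prod y x) /\
  (forall A B : V, prod (prod (prod A A) B) A = prod (prod A A) (prod B A)) /\
  (forall A : V, prod I A = A) /\
  (forall A B : V, `|prod A B| <= `|A| * `|B|) /\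
  (forall A : V, `|prod A A| = `|A| ^+ 2) /\
  (forall A B : V, `|prod A A| <= `|prod A A + prod B B|).

Definition is_state (R : realType) (V : completeNormedModType R)
  (prod : V -> V -> V) (I : V) (w : V -> R) : Prop :=
  (forall (a : R) (x y : V), w (a *: x + y) = a * w x + w y) /\
  continuous w /\
  w I = 1 /\
  (forall A : V, 0 <= w (prod A A)).

Definition state_space (R : realType) (V : completeNormedModType R)
  (prod : V -> V -> V) (I : V) : set (V -> R) :=
  [set w | is_state prod I w].

Definition extreme_points (R : realType) (E : lmodType R) (K : set E) : set E :=
  [set x | K x /\ forall (y z : E) (l : R), K y -> K z -> 0 < l -> l < 1 ->
      x = l *: y + (1 - l) *: z -> y = x /\ z = x].

Definition is_simplex (R : realType) (E : lmodType R) (K : set E) : Prop :=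
  forall (w x y z : E) (l m : R),
    extreme_points K w -> extreme_points K x ->
    extreme_points K y -> extreme_points K z ->
    0 < l -> l < 1 -> 0 < m -> m < 1 ->
    l *: w + (1 - l) *: x = m *: y + (1 - m) *: z -> w = y \/ w = z.

Definition affine_iso (R : realType) (E : lmodType R) (K : set E)
  (V : Type) (S : set (V -> R)) (f : E -> (V -> R)) : Prop :=
  set_bij K S f /\
  forall (x y : E) (l : R), K x -> K y -> 0 <= l -> l <= 1 ->
    f (l *: x + (1 - l) *: y) = (fun A => l * f x A + (1 - l) * f y A).

(* Main.v *)
Require Import Defs.
From HB Require Import structures.
From mathcomp Require Import all_boot all_order all_algebra.
From mathcomp Require Import all_classical all_reals all_analysis.
From mathcomp Require Import ring lra.
Import Order.TTheory GRing.Theory Num.Theory.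
Import numFieldNormedType.Exports.
Local Open Scope classical_set_scope.
Local Open Scope ring_scope.

(** For [|a| <= 1] let [L_a x = a x]. The heart of the proof is that the
    one-parameter group [exp (t L_a)] preserves positivity of functionals: its
    generator satisfies a quantitative version of "[w >= 0] and [w (y ^ 2) = 0]
    imply [w (a y ^ 2) = 0]", and the flow is approximated by small steps.
    As the inverse of [exp (t L_a)] is [exp (- t L_a)], the normalised dual flow
    maps pure states to pure states. A pure state [w] fixed by all these
    flows satisfies [w (a b) = w a * w b] for all [a], [b]; any other pure
    state moves along a nonconstant continuous curve of pure states, which is
    uncountable. If all pure states are multiplicative, then evaluating an
    identity [l w + (1 - l) x = m y + (1 - m) z] at the square of
    [(a - y a) (b - z b)] shows that the state space is a simplex. *)

(** * Mean value theorem and a uniqueness principle for chains of derivatives *)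

(** The convex parameter [l] covers steps of either sign, and [a = b] as well. *)
Lemma MVT_between (R : realType) (f df : R -> R) (a b : R) :
  (forall x, is_derive x (1 : R) f (df x)) ->
  exists2 l, 0 <= l <= 1 & f b - f a = df (a + l * (b - a)) * (b - a).
Proof.
move=> fdf.
have fc x : {for x, continuous f}.
  by apply: differentiable_continuous; apply/derivable1_diffP; apply: ex_derive.
have pos (c d : R) : c < d ->
    exists2 l, 0 <= l <= 1 & f d - f c = df (c + l * (d - c)) * (d - c).
  move=> cd.
  have [x xcd fx] : exists2 x, x \in `]c, d[ & f d - f c = df x * (d - c).
    by apply: MVT => //; apply: continuous_subspaceT => x; exact: fc.
  have dc0 : 0 < d - c by lra.
  move: xcd; rewrite in_itv /= => /andP[cx xd].
  exists ((x - c) / (d - c)).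
    by rewrite divr_ge0 ?ler_pdivrMr//=; lra.
  by rewrite divfK ?gt_eqF// [c + _]addrC subrK.
have [ab|ba|->] := ltgtP a b; first exact: pos.
  have [l l01 fl] := pos _ _ ba; exists (1 - l); first by lra.
  rewrite -[a - b]opprB mulrN in fl.
  have -> : a + (1 - l) * (b - a) = b + l * - (b - a) by ring.
  by lra.
by exists 0; rewrite ?lexx ?ler01// !subrr mulr0.
Qed.

(** Iterating the mean value theorem gives [|U m r| <= M |r| ^ k] for every [k], uniformly in [m];
    for [|s| < 1] the bound tends to 0 as [k] grows. *)
Lemma derive_family_eq0 (R : realType) (U : nat -> R -> R) (M : R) :
  (forall n s, is_derive s (1 : R) (U n) (U n.+1 s)) -> (forall n, U n 0 = 0) ->
  (forall n s, `|s| <= 1 -> `|U n s| <= M) ->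
  forall n s, `|s| < 1 -> U n s = 0.
Proof.
move=> dU U0 UM n s s1.
have key k : forall m r, `|r| <= 1 -> `|U m r| <= M * `|r| ^+ k.
  elim: k => [|k ih] m r r1; first by rewrite expr0 mulr1 UM.
  have [l /andP[l0 l1]] := @MVT_between _ _ _ 0 r (dU m).
  rewrite U0 !subr0 add0r => ->; rewrite normrM exprSr mulrA ler_wpM2r//.
  have lr : `|l * r| <= `|r| by rewrite normrM ger0_norm// ler_piMl.
  have M0 : 0 <= M by apply: le_trans (UM m r r1).
  apply: le_trans (ih _ _ (le_trans lr r1)) _.
  by rewrite ler_wpM2l// lerXn2r// nnegrE.
have h : (fun k => M * `|s| ^+ k) @ \oo --> M * 0.
  by apply: cvgMr; apply: cvg_expr; rewrite normr_id.
apply/eqP; rewrite -normr_eq0 eq_le normr_ge0 andbT.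
rewrite mulr0 in h; rewrite -(cvg_lim _ h)//.
apply: limr_ge; first by apply/cvg_ex; exists 0.
by apply: nearW => k; apply: key; exact: ltW.
Qed.

(** * Exponential generating functions *)

Definition egf {R : realType} (c : nat -> R) (t : R) : R :=
  limn (pseries (fun n => c n / n`!%:R) t).

Section egf.
Context {R : realType}.
Implicit Types (c d : nat -> R) (B t : R).

Lemma egf_normed_cvg c B t : (forall n, `|c n| <= B) ->
  cvgn [normed series (fun n => c n / n`!%:R * t ^+ n)].
Proof.
move=> cB; have B0 : 0 <= B by exact: le_trans (cB 0%N).
apply: (@series_le_cvg _ _ (B *: exp_coeff `|t|)) => [n|n|n|].
- exact: normr_ge0.
- by rewrite /= mulr_ge0// exp_coeff_ge0.
- rewrite /= /exp_coeff /= !normrM normrX normfV normr_nat.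
  by rewrite -!mulrA ler_pM// mulrC.
- by apply: is_cvg_seriesZ; exact: is_cvg_series_exp_coeff.
Qed.

Lemma egf_cvg c B t : (forall n, `|c n| <= B) ->
  cvgn (pseries (fun n => c n / n`!%:R) t).
Proof. by move=> cB; apply: normed_cvg; exact: egf_normed_cvg cB. Qed.

Lemma egf_le c B t : (forall n, `|c n| <= B) -> `|egf c t| <= B * expR `|t|.
Proof.
move=> cB; apply: le_trans (lim_series_norm (egf_normed_cvg _ _ t cB)) _.
have <- : limn (series (B *: exp_coeff `|t|)) = B * expR `|t|.
  by rewrite lim_seriesZ//; exact: is_cvg_series_exp_coeff.
apply: lim_series_le; first exact: egf_normed_cvg cB.
  by apply: is_cvg_seriesZ; exact: is_cvg_series_exp_coeff.
move=> n /=; rewrite /exp_coeff /= !normrM normrX normfV normr_nat.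
by rewrite -!mulrA ler_pM// mulrC.
Qed.

Lemma egf0 c : egf c 0 = c 0.
Proof.
(* The partial sum of index 0 is empty, so the partial sums are constant only after a shift by
   one. *)
rewrite /egf; apply: cvg_lim => //; rewrite -cvg_shiftS.
rewrite (_ : (fun _ => _) = fun=> c 0); first exact: cvg_cst.
apply/funext => n /=; rewrite /pseries /series /= big_nat_recl//= big1.
  by rewrite expr0 mulr1 fact0 divr1 addr0.
by move=> i _; rewrite expr0n mulr0.
Qed.

Lemma egf_linear c d B D k t : (forall n, `|c n| <= B) ->
  (forall n, `|d n| <= D) ->
  egf (fun n => k * c n + d n) t = k * egf c t + egf d t.
Proof.
move=> /egf_cvg cB /egf_cvg dD.
have ckB := @is_cvg_seriesZ _ _ k (cB t).
have := lim_seriesD ckB (dD t); rewrite (lim_seriesZ k (cB t)) => <-.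
congr (limn (series _)); apply/funext => n.
rewrite /= !fctE /= -[_ *: _]/(_ * _); ring.
Qed.

Lemma is_derive_egf c B t : (forall n, `|c n| <= B) ->
  is_derive t (1 : R) (egf c) (egf (fun n => c n.+1) t).
Proof.
move=> cB; have dif (e : nat -> R) :
    pseries_diffs (fun n => e n / n`!%:R) = fun n => e n.+1 / n`!%:R.
  apply/funext => n; rewrite /pseries_diffs factS natrM invfM.
  by rewrite mulrCA [X in _ * X]mulrA divff ?pnatr_eq0// mul1r.
(* Termwise differentiation needs convergence at a point of modulus larger than [|t|]; [|t| + 1]
   serves. *)
have := @pseries_snd_diffs _ (fun n => c n / n`!%:R) (`|t| + 1) t.
rewrite !dif; apply.
- exact: egf_cvg cB.
- by apply: egf_cvg => n; exact: cB.
- by apply: egf_cvg => n; exact: cB.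
- by rewrite [ltRHS]ger0_norm ?ltrDl ?ltr01// addr_ge0.
Qed.

(* Both sides, as functions of [s] with [c] replaced by its shifts, solve
   [u_n' = u_(n+1)] with the same initial values. *)
Lemma egf_shift c B t s : (forall n, `|c n| <= B) -> `|s| < 1 ->
  egf (fun k => egf (fun n => c (n + k)%N) t) s = egf c (t + s).
Proof.
move=> cB s1.
pose A i r := egf (fun k => egf (fun n => c (n + (k + i))%N) t) r.
pose C i r := egf (fun n => c (n + i)%N) (t + r).
have B0 : 0 <= B by exact: le_trans (cB 0%N).
have AB i k : `|egf (fun n => c (n + (k + i))%N) t| <= B * expR `|t|.
  by apply: egf_le => n; exact: cB.
suff : A 0%N s - C 0%N s = 0.
  move/eqP; rewrite subr_eq0 => /eqP; rewrite /A /C.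
  under eq_fun do under eq_fun do rewrite addn0.
  by under [X in _ = egf X _ -> _]eq_fun do rewrite addn0.
apply: (@derive_family_eq0 _ (fun i r => A i r - C i r)
  (B * expR `|t| * expR 1 + B * expR (`|t| + 1))) => //.
- move=> i r; apply: is_deriveB.
    have := is_derive_egf _ _ r (AB i).
    by under [X in is_derive _ _ _ (egf X _)]eq_fun do under eq_fun do rewrite addSnnS.
  have d1 : is_derive (t + r) (1 : R) (egf (fun n => c (n + i)%N))
      (egf (fun n => c (n + i.+1)%N) (t + r)).
    have := @is_derive_egf (fun n => c (n + i)%N) B (t + r) (fun n => cB _).
    by under [X in is_derive _ _ _ (egf X _)]eq_fun do rewrite addSnnS.
  have d2 : is_derive r (1 : R) (fun x => t + x) (0 + 1).
    by apply: is_deriveD.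
  have := is_derive1_comp d1 d2.
  by rewrite add0r mulr1.
- move=> i; rewrite /A /C egf0 addr0 add0n; exact: subrr.
- move=> i r r1; apply: (le_trans (ler_normB _ _)); apply: lerD.
    apply: le_trans (egf_le _ _ _ (AB i)) _.
    by rewrite ler_wpM2l ?mulr_ge0 ?expR_ge0// ler_expR.
  apply: le_trans (egf_le _ B _ (fun n => cB _)) _.
  rewrite ler_wpM2l// ler_expR; apply: le_trans (ler_normD _ _) _.
  by rewrite lerD2l.
Qed.

End egf.

(** * Jordan-Banach algebras *)

Section JB_algebra.
Context {R : realType} {V : completeNormedModType R}.
Context {prod : V -> V -> V} {I : V} (jb : is_JB_algebra prod I).
Implicit Types (x y z a : V) (phi psi w : V -> R) (k t : R).

Definition is_linear phi :=
  forall k x y, phi (k *: x + y) = k * phi x + phi y.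

(** An explicit constant rather than continuity: the flow is estimated with constants uniform in
    time. *)
Definition norm_le (B : R) phi := forall x, `|phi x| <= B * `|x|.

Definition sq_ge0 phi := forall y, 0 <= phi (prod y y).

(** Positivity up to a deficit [m]: a small step of the approximated flow is controlled only
    approximately, and the deficits are accumulated. For linear [phi] and [m = 0], scaling recovers
    [sq_ge0]. *)
Definition sq_ge (m : R) phi := forall y, `|y| <= 1 -> - m <= phi (prod y y).

Lemma prodC x y : prod x y = prod y x.
Proof. by case: jb => _ []. Qed.

Lemma prod1x x : prod I x = x.
Proof. by case: jb => _ [_ [_ []]]. Qed.

Lemma normM_le x y : `|prod x y| <= `|x| * `|y|.
Proof. by case: jb => _ [_ [_ [_ []]]]. Qed.

Lemma norm_sq x : `|prod x x| = `|x| ^+ 2.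
Proof. by case: jb => _ [_ [_ [_ [_ []]]]]. Qed.

Lemma norm_sqD x y : `|prod x x| <= `|prod x x + prod y y|.
Proof. by case: jb => _ [_ [_ [_ [_ []]]]]. Qed.

Lemma prod_linear k x y z : prod (k *: x + y) z = k *: prod x z + prod y z.
Proof. by case: jb. Qed.

Lemma prodDl x y z : prod (x + y) z = prod x z + prod y z.
Proof. by have := prod_linear 1 x y z; rewrite !scale1r. Qed.

Lemma prod0l z : prod 0 z = 0.
Proof. by apply: (@addrI _ (prod 0 z)); rewrite -prodDl !addr0. Qed.

Lemma prodZl k x z : prod (k *: x) z = k *: prod x z.
Proof. by have := prod_linear k x 0 z; rewrite prod0l !addr0. Qed.

Lemma prodDr x y z : prod z (x + y) = prod z x + prod z y.
Proof. by rewrite prodC prodDl ![prod _ z]prodC. Qed.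

Lemma prodZr k x z : prod z (k *: x) = k *: prod z x.
Proof. by rewrite prodC prodZl prodC. Qed.

Lemma prod_cube y : prod y (prod (prod y y) y) = prod (prod y y) (prod y y).
Proof.
by case: jb => _ [_ [jordan _]]; rewrite -jordan prodC.
Qed.

(** As [I] is idempotent, its norm is 0 or 1; the zero algebra is allowed. *)
Lemma norm_unit_le1 : `|I| <= 1.
Proof.
have := norm_sq I; rewrite prod1x expr2 => eI.
have [->|I0] := eqVneq `|I| 0; first exact: ler01.
by rewrite -(mulfI I0 (esym (etrans (mulr1 _) eI))).
Qed.

Lemma sqD k x y : prod (x + k *: y) (x + k *: y) =
  prod x x + (2 * k) *: prod x y + k ^+ 2 *: prod y y.
Proof.
rewrite !(prodDl, prodDr, prodZl, prodZr) (prodC y x) scalerA -expr2.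
by rewrite mulr_natl mulr2n scalerDl !addrA.
Qed.

Lemma norm_prod_le1 x y : `|x| <= 1 -> `|y| <= 1 -> `|prod x y| <= 1.
Proof. by move=> x1 y1; apply: le_trans (normM_le x y) _; rewrite mulr_ile1. Qed.

(* [z ^ 2 + e (1 - y ^ 2) ^ 2] is a polynomial in [y] with nonnegative
   coefficients summing to [(1 - e / 2) ^ 2]. *)
Lemma norm_cube_perturb (e : R) y : 0 < e <= 1 / 2 -> `|y| <= 1 ->
  `|y + (- (e / 2)) *: prod (prod y y) y| <= 1 - e / 2.
Proof.
move=> /andP[e0 e2] y1; set y3 := prod (prod y y) y.
set z := y + _.
have ny2 : `|prod y y| <= 1 by exact: norm_prod_le1.
have ny3 : `|prod y3 y3| <= 1 by do !apply: norm_prod_le1.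
(* The square of [b] is [e (1 - y ^ 2) ^ 2]; by [norm_sqD], a bound on the sum of the squares bounds
   [z ^ 2]. *)
set b := Num.sqrt e *: (I + (-1) *: prod y y).
have zb : prod z z + prod b b =
    e *: I + (1 - 2 * e) *: prod y y + (e ^+ 2 / 4) *: prod y3 y3.
  rewrite /z /b prodZl prodZr scalerA -expr2 sqr_sqrtr ?ltW// !sqD prod_cube.
  rewrite !prod1x !scalerDr !scalerA.
  set p := prod y y; set q := prod p p; set r := prod y3 y3.
  have -> : 2 * - (e / 2) = - e by lra.
  have -> : (- (e / 2)) ^+ 2 = e ^+ 2 / 4 by field.
  have -> : e * (-1) ^+ 2 = e by ring.
  have -> : 1 - 2 * e = 1 + e * (2 * -1) by ring.
  rewrite [(1 + _) *: p]scalerDl scale1r scaleNr.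
  by rewrite [LHS](AC (3*3) (4*(1*5)*3*(2*6)))/= addNr addr0.
have e4 : 0 <= e ^+ 2 / 4 by rewrite divr_ge0// sqr_ge0.
have : `|prod z z| <= (1 - e / 2) ^+ 2.
  apply: le_trans (norm_sqD z b) _; rewrite zb.
  apply: le_trans (ler_normD _ _) _.
  apply: (@le_trans _ _ (e * 1 + (1 - 2 * e) * 1 + e ^+ 2 / 4 * 1)).
    apply: lerD.
      apply: le_trans (ler_normD _ _) _; rewrite !normrZ.
      rewrite (ger0_norm (ltW e0)) (@ger0_norm _ (1 - _)); last by lra.
      by apply: lerD; rewrite ler_wpM2l ?norm_unit_le1//; lra.
    by rewrite normrZ ger0_norm// ler_wpM2l.
  by rewrite !mulr1 le_eqVlt; apply/orP; left; apply/eqP; field.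
by rewrite norm_sq ler_pXn2r// nnegrE ?normr_ge0//; lra.
Qed.

Section functional.
Context {phi : V -> R} (lphi : is_linear phi).

Lemma is_linearD x y : phi (x + y) = phi x + phi y.
Proof. by have := lphi 1 x y; rewrite scale1r mul1r. Qed.

Lemma is_linear0 : phi 0 = 0.
Proof. by apply: (@addrI _ (phi 0)); rewrite -is_linearD !addr0. Qed.

Lemma is_linearZ k x : phi (k *: x) = k * phi x.
Proof. by have := lphi k x 0; rewrite is_linear0 !addr0. Qed.

Lemma sq_ge_scale (m r : R) z : sq_ge m phi -> 0 < r -> `|z| <= r ->
  - m * r ^+ 2 <= phi (prod z z).
Proof.
move=> mphi r0 zr; have := mphi (r^-1 *: z).
rewrite normrZ gtr0_norm ?invr_gt0// mulrC ler_pdivrMr// mul1r => /(_ zr).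
rewrite prodZl prodZr !is_linearZ mulrA -invfM -expr2 mulrC ler_pdivlMr//.
exact: exprn_gt0.
Qed.

(* With [z = y - (e / 2) y ^ 3] and [v = y ^ 2 + (h / 2 e) a], the element
   [y ^ 2 + h (a y ^ 2)] is [z ^ 2 + e v ^ 2] up to terms of second order. *)
Lemma sq_ge_step (B m e h : R) a : 0 <= B -> norm_le B phi ->
  0 <= m -> sq_ge m phi ->
  0 < e <= 1 / 2 -> `|a| <= 1 ->
  sq_ge (m * (1 + e ^+ 2 / 4 + `|h| + `|h| ^+ 2 / (4 * e))
         + B * (e ^+ 2 / 4 + `|h| ^+ 2 / (4 * e)))
    (fun x => phi x + h * phi (prod a x)).
Proof.
move=> B0 Bphi m0 mphi /[dup] ee /andP[e0 e2] a1 y y1.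
have zle := norm_cube_perturb _ _ ee y1.
set y3 := prod (prod y y) y in zle *.
set z := y + _ in zle.
pose v := prod y y + (h / (2 * e)) *: a.
have vle : `|v| <= 1 + `|h| / (2 * e).
  apply: le_trans (ler_normD _ _) _; rewrite norm_sq lerD ?expr_le1//.
  rewrite normrZ normrM normfV [`|2 * e|]ger0_norm; last by lra.
  by rewrite ler_piMr// divr_ge0//; lra.
have zge : - m * (1 - e / 2) ^+ 2 <= phi (prod z z).
  by apply: sq_ge_scale => //; lra.
have vge : - m * (1 + `|h| / (2 * e)) ^+ 2 <= phi (prod v v).
  apply: sq_ge_scale => //.
  by rewrite ltr_pwDl// divr_ge0//; lra.
have phile x : `|x| <= 1 -> phi x <= B.
  move=> x1; apply: le_trans (ler_norm _) _; apply: le_trans (Bphi _) _.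
  by rewrite ler_piMr.
have age : phi (prod a a) <= B by apply/phile/norm_prod_le1.
have y3le : phi (prod y3 y3) <= B by apply: phile; do !apply: norm_prod_le1.
move: zge vge; rewrite /z /v !sqD prod_cube !(is_linearD, is_linearZ) [prod _ a]prodC.
set p := phi (prod y y); set q := phi (prod (prod y y) _).
set c := phi (prod a _); set r := phi (prod y3 y3) in y3le *.
set d := phi _ in age *.
move=> zge vge; have ne : e != 0 by rewrite gt_eqF.
set n := `|h| in vge *.
have hn : h ^+ 2 = n ^+ 2 by rewrite /n real_normK// num_real.
(* The terms in [q] cancel between [z ^ 2] and [e v ^ 2], and the coefficient [h / (2 e)] in [v]
   turns the cross term of [e v ^ 2] into exactly [h c]. *)
have -> : p + h * c = (p + 2 * - (e / 2) * q + (- (e / 2)) ^+ 2 * r) +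
    e * (q + 2 * (h / (2 * e)) * c + (h / (2 * e)) ^+ 2 * d)
    + (e ^+ 2 / 4 * - r + n ^+ 2 / (4 * e) * - d).
  by rewrite -hn; field.
(* The first-order gain [- e] in [(1 - e / 2) ^ 2] cancels the [e] contributed by the second square.
   This is why [y] had to be perturbed to an element of smaller norm. *)
apply: (@le_trans _ _ (- m * (1 - e / 2) ^+ 2
    + e * (- m * (1 + n / (2 * e)) ^+ 2)
    + (e ^+ 2 / 4 * - B + n ^+ 2 / (4 * e) * - B))).
  by rewrite le_eqVlt; apply/orP; left; apply/eqP; field.
apply: lerD; first by rewrite lerD// ler_wpM2l// ltW.
by apply: lerD; rewrite ler_wpM2l ?lerN2// divr_ge0 ?sqr_ge0//; lra.
Qed.

End functional.

(** * The dual flow of [exp (t L_a)] *)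

(** Applying [phi] to each term turns the operator exponential into a scalar series, so no
    convergence in [V] is involved. *)
Definition flow a t phi x := egf (fun n => phi (iter n (prod a) x)) t.

Section flow.
Context {a : V} (a1 : `|a| <= 1).

Lemma norm_iter_le n x : `|iter n (prod a) x| <= `|x|.
Proof.
elim: n => //= n ih; apply: le_trans (normM_le _ _) _.
by apply: le_trans ih; rewrite ler_piMl.
Qed.

Lemma flow_seq_le B phi x : 0 <= B -> norm_le B phi ->
  forall n, `|phi (iter n (prod a) x)| <= B * `|x|.
Proof.
move=> B0 Bphi n; apply: le_trans (Bphi _) _.
by rewrite ler_wpM2l// norm_iter_le.
Qed.

Lemma flow_linear B phi t : 0 <= B -> norm_le B phi -> is_linear phi ->
  is_linear (flow a t phi).
Proof.
move=> B0 Bphi lphi k x y; rewrite /flow.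
have itl n : iter n (prod a) (k *: x + y) =
    k *: iter n (prod a) x + iter n (prod a) y.
  by elim: n => //= n ->; rewrite prodDr prodZr.
under eq_fun do rewrite itl lphi.
by rewrite (egf_linear _ _ (B * `|x|) (B * `|y|))//; exact: flow_seq_le.
Qed.

Lemma flow_norm B phi t : 0 <= B -> norm_le B phi ->
  norm_le (B * expR `|t|) (flow a t phi).
Proof.
move=> B0 Bphi x; rewrite mulrAC; apply: egf_le; exact: flow_seq_le.
Qed.

Lemma flow0 phi : flow a 0 phi = phi.
Proof. by apply/funext => x; rewrite /flow egf0. Qed.

Lemma is_derive_flow B phi x t : 0 <= B -> norm_le B phi ->
  is_derive t (1 : R) (fun t => flow a t phi x) (flow a t phi (prod a x)).
Proof.
move=> B0 Bphi; rewrite /flow.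
have := is_derive_egf _ _ t (flow_seq_le _ _ x B0 Bphi).
by under [X in is_derive _ _ _ (egf X _)]eq_fun do rewrite iterSr.
Qed.

Lemma flowD B phi t s : 0 <= B -> norm_le B phi -> `|s| < 1 ->
  flow a s (flow a t phi) = flow a (t + s) phi.
Proof.
move=> B0 Bphi s1; apply/funext => x; rewrite /flow.
rewrite -(egf_shift _ _ t s (flow_seq_le _ _ x B0 Bphi) s1).
congr (egf _ s); apply/funext => k; congr (egf _ t).
by apply/funext => n; rewrite iterD.
Qed.

Lemma flow_comb B phi psi k t : 0 <= B -> norm_le B phi -> norm_le B psi ->
  flow a t (fun x => k * phi x + psi x) =
  (fun x => k * flow a t phi x + flow a t psi x).
Proof.
move=> B0 Bphi Bpsi; apply/funext => x; rewrite /flow.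
by rewrite (egf_linear _ _ (B * `|x|) (B * `|x|))//; exact: flow_seq_le.
Qed.

(** Two mean value steps express the remainder as [h] times [l h] times a second derivative at an
    intermediate time, which [flow_norm] bounds. *)
Lemma flow_taylor B phi t h x : 0 <= B -> norm_le B phi ->
  `|t| <= 1 -> `|t + h| <= 1 ->
  `|flow a (t + h) phi x - flow a t phi x - h * flow a t phi (prod a x)|
  <= `|h| ^+ 2 * (B * expR 1) * `|x|.
Proof.
move=> B0 Bphi t1 th1.
have [l /andP[l0 l1]] := @MVT_between _ _ _ t (t + h)
  (fun r => is_derive_flow _ _ x r B0 Bphi).
rewrite [t + h - t]addrAC subrr add0r => ->.
rewrite [_ * h]mulrC -mulrBr.
have [j /andP[j0 j1]] := @MVT_between _ _ _ t (t + l * h)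
  (fun r => is_derive_flow _ _ (prod a x) r B0 Bphi).
rewrite [t + _ - t]addrAC subrr add0r => ->.
set r := t + _; rewrite !normrM (ger0_norm l0) expr2 -!mulrA.
rewrite ler_wpM2l// [leLHS](_ : _ = `|h| * (l * `|flow a r phi (prod a (prod a x))|)).
  rewrite ler_wpM2l//; apply: (@le_trans _ _ `|flow a r phi (prod a (prod a x))|).
    by rewrite ler_piMl.
  rewrite mulrA; apply: le_trans (flow_norm _ _ _ B0 Bphi _) _.
  apply: ler_pM => //; first by rewrite mulr_ge0// expR_ge0.
    rewrite ler_wpM2l// ler_expR.
    (* The intermediate time is a convex combination of [t] and [t + h], hence stays in the unit
       interval around 0. *)
    have -> : r = (1 - j * l) * t + j * l * (t + h) by rewrite /r; ring.
    have jl0 : 0 <= j * l by rewrite mulr_ge0.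
    have jl1 : j * l <= 1 by rewrite mulr_ile1.
    apply: le_trans (ler_normD _ _) _; rewrite !normrM.
    rewrite (ger0_norm j0) (ger0_norm l0) (@ger0_norm _ (1 - _)); last by lra.
    by nra.
  exact: norm_iter_le 2%N x.
by ring.
Qed.

(* Step size [h ~ u ^ 4] and [e = u ^ 3] in [sq_ge_step]: both error terms [e ^ 2]
   and [h ^ 2 / e] are then [o(h)]. *)
Lemma sq_ge_flow_step B m u h phi psi : is_linear phi -> 0 <= B ->
  norm_le B phi -> 0 <= m -> sq_ge m phi -> 0 < u <= 1 / 2 -> `|h| <= u ^+ 4 ->
  (forall x, `|psi x - phi x - h * phi (prod a x)| <= `|h| ^+ 2 * B * `|x|) ->
  sq_ge (m * (1 + 2 * u ^+ 4) + 2 * B * u ^+ 5) psi.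
Proof.
move=> lphi B0 Bphi m0 mphi /andP[u0 u2] hu psiE y y1.
have uge : 0 <= u := ltW u0.
have ule : u <= 1 by lra.
have e01 : 0 < u ^+ 3 <= 1 / 2.
  rewrite exprn_gt0//=; apply: le_trans u2.
  by rewrite exprS ler_piMr// exprn_ile1.
have := sq_ge_step lphi _ _ _ h _ B0 Bphi m0 mphi e01 a1 _ y1.
set s := phi _ + _ => sge.
have := psiE (prod y y); rewrite ler_norml => /andP[+ _].
set n := `|h| in hu sge *; have n0 : 0 <= n by exact: normr_ge0.
move=> pge.
have n2 : n ^+ 2 <= u ^+ 8 by rewrite -[8%N]/(4 * 2)%N exprM
    lerXn2r// nnegrE// exprn_ge0.
have ne : n ^+ 2 / (4 * u ^+ 3) <= u ^+ 5 / 4.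
  rewrite ler_pdivrMr; last by rewrite mulr_gt0// exprn_gt0.
  by apply: le_trans n2 _; rewrite le_eqVlt; apply/orP; left; apply/eqP; field.
have u5 : u ^+ 5 <= u ^+ 4 / 2.
  by rewrite [u ^+ 5]exprSr ler_wpM2l ?exprn_ge0//; lra.
have u6 : (u ^+ 3) ^+ 2 <= u ^+ 5 / 2.
  by rewrite -exprM [u ^+ 6]exprSr ler_wpM2l ?exprn_ge0//; lra.
have u8 : u ^+ 8 <= u ^+ 5 / 8.
  rewrite (exprD _ 5 3) ler_wpM2l ?exprn_ge0//.
  by rewrite (_ : 8^-1 = (1 / 2) ^+ 3); [rewrite lerXn2r// nnegrE; lra|field].
have y2 : n ^+ 2 * B * `|prod y y| <= B * (u ^+ 5 / 8).
  apply: (@le_trans _ _ (n ^+ 2 * B)).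
    by rewrite ler_piMr ?mulr_ge0 ?exprn_ge0// norm_prod_le1.
  by rewrite mulrC ler_wpM2l//; lra.
set E := (u ^+ 3) ^+ 2 in sge u6; set F := n ^+ 2 / _ in sge ne.
have mle : m * (1 + E / 4 + n + F) <= m * (1 + 2 * u ^+ 4).
  by rewrite ler_wpM2l//; lra.
have Ble : B * (E / 4 + F) <= B * (u ^+ 5 * (3 / 8)).
  by rewrite ler_wpM2l//; lra.
have Bu0 : 0 <= B * u ^+ 5 by rewrite mulr_ge0// exprn_ge0// ltW.
rewrite /s in sge pge; move: sge pge mle Ble y2 Bu0.
set P := psi _; set Q := phi _; set S := h * _.
lra.
Qed.

End flow.

(** * The flow preserves positivity *)

Section positivity.
Context {a : V} (a1 : `|a| <= 1).

(** A discrete Gronwall argument: with [u = 1 / n], time [t] is reached in [N = n ^ 4] steps, each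
    sending a deficit [m] to [q m + c]. As [q ^ N <= expR 2] and [N c] is of order [u], the final
    deficit is of order [1 / n]. *)
Lemma sq_ge_flow B phi t n : is_linear phi -> 0 <= B -> norm_le B phi ->
  sq_ge0 phi -> `|t| <= 1 -> (2 <= n)%N ->
  sq_ge (2 * B * expR 3 / n%:R) (flow a t phi).
Proof.
move=> lphi B0 Bphi phi0 t1 n2.
pose u : R := n%:R^-1; pose N := (n ^ 4)%N; pose h := t * u ^+ 4.
have n0 : 0 < n%:R :> R by rewrite ltr0n (leq_trans _ n2).
have u0 : 0 < u by rewrite invr_gt0.
have u2 : u <= 1 / 2.
  by rewrite /u div1r lef_pV2 ?posrE// ler_nat.
have Nu : N%:R * u ^+ 4 = 1 by rewrite /N natrX /u -exprMn divff ?expr1n// gt_eqF.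
have uge : 0 <= u := ltW u0.
have u40 : 0 <= u ^+ 4 := exprn_ge0 _ uge.
have hu : `|h| <= u ^+ 4.
  by rewrite normrM (ger0_norm u40) ler_piMl.
pose B' := B * expR 1; pose q := 1 + 2 * u ^+ 4; pose c := 2 * B' * u ^+ 5.
have B'0 : 0 <= B' by rewrite mulr_ge0 ?expR_ge0.
have c0 : 0 <= c by rewrite !mulr_ge0// exprn_ge0.
have q1 : 1 <= q by rewrite lerDl mulr_ge0.
have jh j : (j <= N)%N -> `|j%:R * h| <= 1.
  move=> jN; rewrite normrM normr_nat -[leRHS]Nu.
  by apply: ler_pM; rewrite ?ler0n ?ler_nat.
(* A closed upper bound for the recursion: [j] contributions [c], each amplified by at most
   [q ^ j]. *)
have key j : (j <= N)%N -> sq_ge (q ^+ j * (j%:R * c)) (flow a (j%:R * h) phi).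
  elim: j => [_ y y1|j ih jN y y1].
    by rewrite !mul0r mulr0 oppr0 flow0.
  have jN' := ltnW jN.
  have m0 : 0 <= q ^+ j * (j%:R * c).
    by rewrite mulr_ge0 ?mulr_ge0// exprn_ge0; lra.
  have nle : norm_le B' (flow a (j%:R * h) phi).
    move=> x; apply: le_trans (flow_norm a1 _ _ _ B0 Bphi _) _.
    by rewrite ler_wpM2r// ler_wpM2l// ler_expR jh.
  have u02 : 0 < u <= 1 / 2 by rewrite u0.
  have jhD : j.+1%:R * h = j%:R * h + h by rewrite -natr1 mulrDl mul1r.
  have taylor x := flow_taylor a1 _ _ (j%:R * h) h x B0 Bphi (jh _ jN').
  rewrite -jhD in taylor.
  have := sq_ge_flow_step a1 _ _ _ _ _ (flow a (j.+1%:R * h) phi)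
    (flow_linear a1 _ _ _ B0 Bphi lphi) B'0 nle m0 (ih jN') u02 hu
    (fun x => taylor x (jh _ jN)) _ y1.
  apply: le_trans.
  rewrite lerN2 -/q -/c.
  have -> : q ^+ j.+1 * (j.+1%:R * c) =
      q ^+ j * (j%:R * c) * q + q ^+ j.+1 * c.
    by rewrite -[j.+1%:R]natr1 exprSr; ring.
  by rewrite lerD2l ler_peMl// exprn_ege1.
have hN : N%:R * h = t by rewrite /h mulrCA Nu mulr1.
have := key N (leqnn N); rewrite hN => kN y y1; apply: le_trans (kN y y1).
have qN : q ^+ N <= expR 2.
  have <- : expR (2 * u ^+ 4) ^+ N = expR 2.
    by rewrite -expRM_natl mulrCA Nu mulr1.
  by rewrite lerXn2r ?nnegrE ?expR_ge0 ?expR_ge1Dx//; lra.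
rewrite lerN2; have -> : N%:R * c = 2 * B' * u.
  by rewrite /c exprSr [_ * u]mulrC mulrCA [N%:R * _]mulrCA Nu mulr1; ring.
have -> : 2 * B * expR 3 / n%:R = expR 2 * (2 * B' * u).
  by rewrite (_ : 3 = 2 + 1)// ?expRD /B' /u; ring.
by rewrite ler_wpM2r// !mulr_ge0// ltW.
Qed.

Lemma flow_ge0 B phi t : is_linear phi -> 0 <= B -> norm_le B phi ->
  sq_ge0 phi -> `|t| <= 1 -> sq_ge0 (flow a t phi).
Proof.
move=> lphi B0 Bphi phi0 t1.
suff sq1 : sq_ge 0 (flow a t phi).
  move=> y; have y0 : 0 < `|y| + 1 by rewrite ltr_wpDl.
  have := sq_ge_scale (flow_linear a1 _ _ t B0 Bphi lphi) _ _ y sq1 y0.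
  by rewrite oppr0 mul0r; apply; rewrite lerDl.
move=> y y1; rewrite oppr0 leNgt; apply/negP => neg.
set v := flow a t phi _ in neg; pose C := 2 * B * expR 3.
have C0 : 0 <= C by rewrite !mulr_ge0 ?expR_ge0.
(* For [n > C / - v] the deficit [C / n] is below [- v], a contradiction; the [.+2] secures
   [2 <= n]. *)
pose n := (Num.bound (C / - v)).+2.
have := sq_ge_flow _ _ t n lphi B0 Bphi phi0 t1 isT y y1.
rewrite -/v -/C lerNl; apply/negP; rewrite -ltNge.
rewrite ltr_pdivrMr ?ltr0n// mulrC -ltr_pdivrMr ?oppr_gt0//.
apply: lt_le_trans (archi_boundP _) _; first by rewrite divr_ge0// oppr_ge0 ltW.
by rewrite ler_nat; do 2!apply: leqW.
Qed.

End positivity.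

(** * States *)

Lemma norm_le_mono B C phi : B <= C -> norm_le B phi -> norm_le C phi.
Proof.
by move=> BC Bphi x; apply: le_trans (Bphi x) _; rewrite ler_wpM2r.
Qed.

Lemma norm_leZ B phi k : norm_le B phi -> norm_le (`|k| * B) (fun x => k * phi x).
Proof. by move=> Bphi x; rewrite normrM -mulrA ler_wpM2l. Qed.

(** When [phi I = 0], the value of [phi] at [(x + k I) ^ 2] is affine in [k] with slope [2 phi x].
    If [phi x] is nonzero, the chosen [k] makes it [- 1]. *)
Lemma sq_ge0_eq0 phi : is_linear phi -> sq_ge0 phi -> phi I = 0 ->
  forall x, phi x = 0.
Proof.
move=> lphi phi0 phiI x; apply/eqP/negPn/negP => nz.
have := phi0 (x + (- (phi (prod x x) + 1) / (2 * phi x)) *: I).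
rewrite sqD prod1x [prod x I]prodC prod1x.
rewrite !(is_linearD lphi) !(is_linearZ lphi) phiI mulr0 addr0.
have -> : 2 * (- (phi (prod x x) + 1) / (2 * phi x)) * phi x =
    - (phi (prod x x) + 1) by field.
lra.
Qed.

Lemma state_norm_le phi : is_state prod I phi ->
  exists2 B, 0 <= B & norm_le B phi.
Proof.
move=> [lphi [cphi _]]; have := cphi 0.
move=> /cvgrPdist_lt/(_ 1 ltr01)/nbhs_ballP[d /= d0 dphi].
exists (2 / d) => [|x]; first by rewrite divr_ge0// ltW.
have [->|x0] := eqVneq x 0.
  by rewrite (is_linear0 lphi) !normr0 mulr0.
have nx0 : 0 < `|x| by rewrite normr_gt0.
have := dphi ((d / 2 / `|x|) *: x).
rewrite -ball_normE /ball_ /= sub0r normrN normrZ => /(_ _)/wrap[].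
  rewrite normrM normfV normr_id divfK ?gt_eqF// gtr0_norm ?divr_gt0//.
  by rewrite gtr_pMr// invf_lt1//; lra.
rewrite (is_linear0 lphi) sub0r normrN (is_linearZ lphi) normrM.
rewrite gtr0_norm ?divr_gt0// => /ltW h.
rewrite -[`|phi x|](mulKf (_ : d / 2 / `|x| != 0)); last by rewrite gt_eqF ?divr_gt0.
apply: le_trans (ler_wpM2l _ h) _; first by rewrite invr_ge0 ltW// !divr_gt0.
by rewrite mulr1 le_eqVlt; apply/orP; left; apply/eqP; field; rewrite !gt_eqF.
Qed.

Lemma norm_le_state B phi : is_linear phi -> norm_le B phi -> sq_ge0 phi ->
  0 < phi I -> is_state prod I (fun x => (phi I)^-1 * phi x).
Proof.
move=> lphi Bphi phi0 pI; split=> [k x y|].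
  by rewrite lphi; ring.
split; last first.
  split; first by rewrite mulVf ?gt_eqF.
  by move=> y; rewrite mulr_ge0 ?invr_ge0 ?(ltW pI)//; exact: phi0.
move=> x; apply: cvgMr; apply/cvgrPdist_lt => e e0.
have B1 : 0 < `|B| + 1 by rewrite ltr_wpDl.
near=> y.
have -> : phi x - phi y = phi (x - y).
  by rewrite (is_linearD lphi) -[- y]scaleN1r (is_linearZ lphi) mulN1r.
apply: le_lt_trans (Bphi _) _.
apply: (@le_lt_trans _ _ ((`|B| + 1) * `|x - y|)).
  by rewrite ler_wpM2r//; apply: le_trans (ler_norm B) _; rewrite lerDl.
rewrite mulrC -ltr_pdivlMr//.
near: y; apply: cvgr_dist_lt; [exact: cvg_id|exact: divr_gt0].
Unshelve. all: by end_near. Qed.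

(* Exchanging [l] and [1 - l] gives [p2 = phi] as well. *)
Definition pure_state phi := is_state prod I phi /\
  forall p1 p2 (l : R), is_state prod I p1 -> is_state prod I p2 ->
    0 < l -> l < 1 -> (forall x, phi x = l * p1 x + (1 - l) * p2 x) -> p1 = phi.

(** * The normalised flow on states and pure states *)

Definition state_flow a t w x := (flow a t w I)^-1 * flow a t w x.

Section pure_flow.
Context {a : V} (a1 : `|a| <= 1).

Lemma flowK B phi t : 0 <= B -> norm_le B phi -> `|t| < 1 ->
  flow a (- t) (flow a t phi) = phi.
Proof.
by move=> B0 Bphi t1; rewrite (flowD a1 B)// ?normrN// subrr flow0.
Qed.

Lemma flow_comb2 B phi psi k j t : 0 <= B -> norm_le B phi -> norm_le B psi ->
  flow a t (fun x => k * phi x + j * psi x) =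
  (fun x => k * flow a t phi x + j * flow a t psi x).
Proof.
move=> B0 Bphi Bpsi.
have flowZ : flow a t (fun x => j * psi x) = fun x => j * flow a t psi x.
  (* [flow_comb] has coefficient 1 on its second term, so [j psi] is split as
     [(j - 1) psi + psi]. *)
  have := flow_comb a1 _ _ _ (j - 1) t B0 Bpsi Bpsi.
  rewrite (_ : (fun x => (j - 1) * psi x + psi x) = fun x => j * psi x).
    by move=> ->; apply/funext => x; ring.
  by apply/funext => x; ring.
rewrite (flow_comb a1 ((1 + `|j|) * B))//; last first.
- apply: norm_le_mono (norm_leZ _ _ j Bpsi).
  by rewrite ler_wpM2r// lerDr.
- by apply: norm_le_mono Bphi; rewrite ler_peMl// lerDl.
- by rewrite mulr_ge0// addr_ge0.
by rewrite flowZ.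
Qed.

(** If the flowed functional vanished at [I], positivity would make it zero, and flowing back would
    give [w = 0], against [w I = 1]. *)
Lemma flow_unit_gt0 w t : is_state prod I w -> `|t| < 1 -> 0 < flow a t w I.
Proof.
move=> sw t1; have [B B0 Bw] := state_norm_le _ sw.
have [lw [_ [w1 w0]]] := sw.
have lf := flow_linear a1 _ _ t B0 Bw lw.
have f0 := flow_ge0 a1 _ _ t lw B0 Bw w0 (ltW t1).
rewrite lt_neqAle -{2}[I]prod1x f0 andbT eq_sym.
apply/eqP => fI.
have fz := sq_ge0_eq0 _ lf f0 fI.
have := flowK _ _ _ B0 Bw t1.
(* The zero functional is written as a combination so that [flow_comb2] computes its flow. *)
have -> : flow a t w = fun x => 0 * w x + 0 * w x.
  by apply/funext => x; rewrite fz !mul0r addr0.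
rewrite (flow_comb2 B)// => /(congr1 (@^~ I)) /=.
by rewrite w1 !mul0r addr0 => /esym/eqP; rewrite oner_eq0.
Qed.

Lemma state_flow_state w t : is_state prod I w -> `|t| < 1 ->
  is_state prod I (state_flow a t w).
Proof.
move=> sw t1; have [B B0 Bw] := state_norm_le _ sw.
have [lw [_ [w1 w0]]] := sw.
apply: (norm_le_state (B * expR `|t|)); last exact: flow_unit_gt0.
- exact: (flow_linear a1 _ _ _ B0 Bw lw).
- exact: (flow_norm a1 _ _ _ B0 Bw).
- exact: (flow_ge0 a1 _ _ _ lw B0 Bw w0 (ltW t1)).
Qed.

(** A convex decomposition of the flowed state is carried back by the inverse flow to one of [w];
    purity of [w] identifies its first component, which is then flowed forward again. *)
Lemma state_flow_pure w t : pure_state w -> `|t| < 1 ->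
  pure_state (state_flow a t w).
Proof.
move=> [sw pw] t1; split; first exact: state_flow_state.
move=> p1 p2 l s1 s2 l0 l1 E.
have [B B0 Bw] := state_norm_le _ sw.
have [B1 B10 Bp1] := state_norm_le _ s1.
have [B2 B20 Bp2] := state_norm_le _ s2.
have t1' : `|- t| < 1 by rewrite normrN.
have c0 := flow_unit_gt0 _ _ sw t1; set c := flow a t w I in c0 *.
pose q1 := flow a (- t) p1; pose q2 := flow a (- t) p2.
have c10 : 0 < q1 I by exact: flow_unit_gt0.
have c20 : 0 < q2 I by exact: flow_unit_gt0.
have wE x : w x = c * l * q1 x + c * (1 - l) * q2 x.
  rewrite -[in LHS](flowK _ _ _ B0 Bw t1).
  have -> : flow a t w = fun x => c * l * p1 x + c * (1 - l) * p2 x.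
    apply/funext => y; have := E y; rewrite /state_flow -/c => /(congr1 ( *%R c)).
    by rewrite mulVKf ?gt_eqF// => ->; ring.
  rewrite (flow_comb2 (B1 + B2))// ?addr_ge0//.
    by apply: norm_le_mono Bp1; rewrite lerDl.
  by apply: norm_le_mono Bp2; rewrite lerDr.
have := wE I; have [_ [_ [w1 _]]] := sw; rewrite w1 => one.
have q1w : state_flow a (- t) p1 = w.
  (* Normalising [q1] and [q2] changes the weights to [c l q1(I)] and [c (1 - l) q2(I)], whose sum
     is [w I = 1]. *)
  apply: (pw _ (state_flow a (- t) p2) (c * l * q1 I)).
  - exact: state_flow_state.
  - exact: state_flow_state.
  - by rewrite !mulr_gt0.
  - by rewrite one ltrDl !mulr_gt0// subr_gt0.
  - move=> x; rewrite [X in X - _]one addrAC subrr add0r /state_flow -/q1 -/q2.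
    by rewrite wE; field; rewrite !gt_eqF.
have p1E : p1 = fun x => q1 I * flow a t w x + 0 * flow a t w x.
  rewrite -(flow_comb2 B)// -[LHS](flowK _ _ (- t) B10 Bp1 t1') opprK.
  congr (flow a t _); apply/funext => x; rewrite mul0r addr0 -q1w.
  by rewrite /state_flow mulVKf// gt_eqF.
have cq1 : q1 I * c = 1.
  have [_ [_ [<- _]]] := s1.
  by rewrite [in RHS]p1E mul0r addr0.
apply/funext => x; rewrite p1E mul0r addr0 /state_flow -/c.
by rewrite -[c^-1]mul1r -cq1 mulfK ?gt_eqF.
Qed.

Lemma flow_nonconstant w x : is_state prod I w -> w x = 0 -> w (prod a x) != 0 ->
  exists2 h, 0 < h <= 1 / 2 & flow a h w x != 0.
Proof.
move=> sw wx wax; have [B B0 Bw] := state_norm_le _ sw.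
(* The Taylor bound at a zero of the flow would give [d <= h (C - 1)], while [h C <= d]; the [+ 1]
   in [C] makes these incompatible. *)
pose C := B * (expR 1 * `|x|) + 1; pose d := `|w (prod a x)|.
have C0 : 0 < C by rewrite ltr_wpDl// !mulr_ge0 ?expR_ge0.
have d0 : 0 < d by rewrite normr_gt0.
pose h := Num.min (1 / 2) (d / C).
have h0 : 0 < h by rewrite lt_min divr_gt0// divr_gt0.
have h2 : h <= 1 / 2 by rewrite ge_min lexx.
exists h; first by rewrite h0.
apply/eqP => fx.
have h1 : `|0 + h| <= 1 by rewrite add0r gtr0_norm//; lra.
have n0 : `|0 : R| <= 1 by rewrite normr0.
have := flow_taylor a1 _ _ 0 h x B0 Bw n0 h1.
rewrite add0r fx flow0 wx subrr sub0r normrN normrM (gtr0_norm h0) -/d.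
rewrite expr2 -!mulrA ler_pM2l// => dh.
have dC : h * C <= d by rewrite -ler_pdivlMr// ge_min lexx orbT.
by rewrite /C mulrDr mulr1 in dC; lra.
Qed.

End pure_flow.

(** * Curves of pure states *)

Lemma continuous_state_flow a w x t : `|a| <= 1 -> is_state prod I w ->
  `|t| < 1 -> {for t, continuous (fun t => state_flow a t w x)}.
Proof.
move=> a1 sw t1; have [B B0 Bw] := state_norm_le _ sw.
have cont z : {for t, continuous (fun t => flow a t w z)}.
  apply: differentiable_continuous; apply/derivable1_diffP.
  have ? := is_derive_flow a1 _ _ z t B0 Bw; exact: ex_derive.
apply: cvgM; last exact: cont.
by apply: cvgV; [rewrite gt_eqF// (flow_unit_gt0 a1)|exact: cont].
Qed.

(** Along the normalised flow of [w] some observable takes two different values, hence by continuity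
    all values between them; pure states with different values are distinct. *)
Lemma pure_state_curve w a b : pure_state w -> w (prod a b) != w a * w b ->
  exists2 p : R -> V -> R, injective p & forall r, pure_state (p r).
Proof.
(* The defect [w (a b) - w a * w b] is homogeneous in [a], so [a] can be scaled into the unit ball;
   the [+ 1] avoids division by zero. *)
move=> pw; wlog a1 : a / `|a| <= 1 => [wlogH|nmul].
  have n0 : 0 < `|a| + 1 by rewrite ltr_wpDl.
  pose k := (`|a| + 1)^-1; have k0 : 0 < k by rewrite invr_gt0.
  have [[lw _] _] := pw.
  move=> nmul; apply: (wlogH (k *: a)).
    by rewrite normrZ gtr0_norm// mulrC ler_pdivrMr// mul1r lerDl.
  rewrite prodZl !(is_linearZ lw) -mulrA; apply: contra nmul => /eqP e.
  by apply/eqP/(mulfI _ e); rewrite gt_eqF.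
have sw := pw.1; have [lw [_ [w1 _]]] := sw.
(* With this shift [w x = 0], and [w (a x)] is exactly the defect of multiplicativity. *)
pose x := b + (- w b) *: I.
have wx : w x = 0 by rewrite (is_linearD lw) (is_linearZ lw) w1 mulr1 subrr.
have wax : w (prod a x) != 0.
  rewrite prodDr prodZr (prodC a I) prod1x.
  by rewrite (is_linearD lw) (is_linearZ lw) mulNr subr_eq0 mulrC.
have [h /andP[h0 h2] fx] := flow_nonconstant a1 _ _ sw wx wax.
pose g t := state_flow a t w x.
have g0 : g 0 = 0 by rewrite /g /state_flow flow0 wx mulr0.
have lt1 t : 0 <= t <= h -> `|t| < 1.
  by move=> /andP[t0 th]; rewrite ger0_norm//; lra.
have gh : g h != 0.
  rewrite mulf_neq0// invr_eq0 gt_eqF// (flow_unit_gt0 a1)// lt1//.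
  by rewrite lexx ltW.
have gc : {within `[0, h], continuous g}.
  apply: continuous_in_subspaceT => t; rewrite inE /= in_itv /= => th.
  exact: (continuous_state_flow _ _ _ _ a1 sw (lt1 _ th)).
(* A logistic function injects the whole line into the values strictly between [g 0 = 0] and [g h],
   whatever the sign of [g h]. *)
pose v r := g h / (1 + expR r).
have e0 r : 0 < 1 + expR r by rewrite ltr_wpDr// expR_ge0.
have vb r : Num.min (g 0) (g h) <= v r <= Num.max (g 0) (g h).
  have s0 : 0 <= (1 + expR r)^-1 by rewrite invr_ge0 ltW.
  have s1 : (1 + expR r)^-1 <= 1 by rewrite invf_le1// lerDl expR_ge0.
  rewrite g0 /v; case: (ltgtP (g h) 0) gh => // gh0 _.
    by rewrite ler_nMr// s1 nmulr_rle0// s0.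
  by rewrite pmulr_rge0// s0 ler_piMr// ltW.
have /(_ _)/cid2 tr r := IVT (ltW h0) gc (vb r).
pose t_ r := s2val (tr r).
have tP r : 0 <= t_ r <= h by have := s2valP (tr r); rewrite in_itv.
have gt_ r : g (t_ r) = v r by exact: s2valP' (tr r).
exists (fun r => state_flow a (t_ r) w) => [r s /(congr1 (@^~ x))|r].
  rewrite -/(g (t_ r)) -/(g (t_ s)) !gt_ => /(mulfI gh)/invr_inj/addrI.
  exact: expR_inj.
exact: (state_flow_pure a1 _ _ pw (lt1 _ (tP r))).
Qed.

Lemma multiplicative_simplex (w x y z : V -> R) (l m : R) :
  is_state prod I w -> is_state prod I x ->
  (forall a b, w (prod a b) = w a * w b) ->
  (forall a b, y (prod a b) = y a * y b) ->
  (forall a b, z (prod a b) = z a * z b) ->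
  is_state prod I y -> is_state prod I z -> 0 < l -> l < 1 ->
  (forall a, l * w a + (1 - l) * x a = m * y a + (1 - m) * z a) ->
  w = y \/ w = z.
Proof.
move=> [lw [_ [w1 w0]]] [_ [_ [_ x0]]] mw my mz [ly [_ [y1 _]]] [lz [_ [z1 _]]].
move=> l0 l1 E; have [|wy] := pselect (w = y); first by left.
right; apply/funext => b; apply/eqP/negPn/negP => wz.
apply: wy; apply/funext => a; apply/eqP/negPn/negP => wy.
(* The first factor is killed by [y] and the second by [z], while [w] kills neither. *)
pose c := prod (a + (- y a) *: I) (b + (- z b) *: I).
have yc : y c = 0 by rewrite my !(is_linearD ly, is_linearZ ly) y1 mulr1 subrr mul0r.
have zc : z c = 0 by rewrite mz !(is_linearD lz, is_linearZ lz) z1 !mulr1 subrr mulr0.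
have wc : w c != 0.
  by rewrite mw !(is_linearD lw, is_linearZ lw) w1 !mulr1 mulf_neq0// subr_eq0.
have := E (prod c c); rewrite mw my mz yc zc !mulr0 addr0.
apply/eqP; rewrite gt_eqF// ltr_pwDl//; last by rewrite mulr_ge0// subr_ge0 ltW.
by rewrite mulr_gt0// -expr2 exprn_even_gt0.
Qed.

(** * Transfer to [K] along the affine isomorphism *)

Context {E : lmodType R} {K : set E} {f : E -> V -> R}.

Context (convK : convex_set K) (isof : affine_iso K (state_space prod I) f).

Lemma convex_comb_in (x y : E) (l : R) : K x -> K y -> 0 <= l -> l <= 1 ->
  K (l *: x + (1 - l) *: y).
Proof.
move=> Kx Ky l0 l1; have := convK x y (Itv01 l0 l1).
by rewrite !inE; apply.
Qed.

Lemma extreme_pure (x : E) : extreme_points K x <-> K x /\ pure_state (f x).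
Proof.
have [[fK finj fsurj] faff] := isof.
split=> [[Kx ext]|[Kx [_ pfx]]]; split=> //.
  split; first exact: fK.
  move=> p1 p2 l /fsurj[y1 Ky1 <-] /fsurj[y2 Ky2 <-] l0 l1 fxE.
  suff xE : x = l *: y1 + (1 - l) *: y2 by have [->] := ext _ _ _ Ky1 Ky2 l0 l1 xE.
  apply: finj; rewrite ?inE//; first by apply: convex_comb_in => //; exact: ltW.
  by rewrite faff ?(ltW l0) ?(ltW l1)//; apply/funext => A; exact: fxE.
move=> y1 y2 l Ky1 Ky2 l0 l1 xE.
have fxE A : f x A = l * f y1 A + (1 - l) * f y2 A.
  by rewrite xE faff ?(ltW l0) ?(ltW l1).
split; apply: finj; rewrite ?inE//.
  by apply: (pfx _ (f y2) l) => //; exact: fK.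
(* Purity identifies only the first component, so the second one follows by exchanging the two
   weights. *)
apply: (pfx _ (f y1) (1 - l)); rewrite ?subr_gt0 ?gtrBl//; try exact: fK.
by move=> A; rewrite fxE; ring.
Qed.

End JB_algebra.

Theorem theorem1 (R : realType) (V : completeNormedModType R)
  (prod : V -> V -> V) (I : V) (E : lmodType R) (K : set E) :
  is_JB_algebra prod I ->
  convex_set K ->
  (exists f : E -> (V -> R), affine_iso K (state_space prod I) f) ->
  ~ is_simplex K ->
  ([set: R] #<= extreme_points K)%card.
Proof.
move=> jb convK [f isof] nsimplex.
have [[fK finj fsurj] faff] := isof.
have extE := extreme_pure convK isof.
(* Either all pure states are multiplicative, and [K] is a simplex, or a single one that is not
   yields the curve. *)
have [mul|] := pselect (forall w, @pure_state _ _ prod I w ->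
    forall a b, w (prod a b) = w a * w b).
  exfalso; apply: nsimplex => w x y z l m.
  move=> /extE[Kw pw] /extE[Kx px] /extE[Ky py] /extE[Kz pz] l0 l1 m0 m1 wxyz.
  have [|e|e] := multiplicative_simplex (f w) (f x) (f y) (f z) l m
    pw.1 px.1 (mul _ pw) (mul _ py) (mul _ pz) py.1 pz.1 l0 l1.
  - move=> A; have := congr1 (@^~ A) (congr1 f wxyz).
    by rewrite !faff// ?(ltW l0) ?(ltW l1) ?(ltW m0) ?(ltW m1).
  - by left; apply: finj; rewrite ?inE.
  - by right; apply: finj; rewrite ?inE.
move=> /existsNP[w /not_implyP[pw /existsNP[a /existsNP[b /eqP nmul]]]].
have [p pinj pp] := pure_state_curve jb w a b pw nmul.
have /choice[e eP] r : exists x, K x /\ f x = p r.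
  by have [x Kx fx] := fsurj (p r) (pp r).1; exists x.
have einj : injective e.
  by move=> r s ers; apply: pinj; rewrite -(eP r).2 -(eP s).2 ers.
rewrite -(card_le_eql (inj_card_eq (in2W einj))).
apply: subset_card_le => _ [r _ <-]; apply/extE.
by rewrite (eP r).2; split; [exact: (eP r).1|exact: pp].
Qed.
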